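(* For every integer $n\ge 1$, the number of necklaces of order $n$ is $2(2n)^{n-2}$.
   Context: A matching on a set of size $2n$ is a partition of it into $n$ subsets of size $2$ (pairs). $\langle 0,2n-1\rangle$ denotes the set $\{0,1,\ldots,2n-1\}$. A matching on it is noncrossing if there are no $i<j<k<\ell$ with $\{i,k\}$ and $\{j,\ell\}$ both pairs. $M'$ is a flip of $M$ if $M'$ is obtained from $M$ by replacing two pairs $\{i,j\},\{k,\ell\}$ of $M$ by $\{i,\ell\},\{j,k\}$. $M(-1)$ is the matching in which $i-1,j-1$ are matched if and only if $i,j$ are matched in $M$ (subtraction modulo $2n$). A necklace of order $n$ is an $n$-tuple $(M_1,\ldots,M_n)$ of noncrossing matchings on $\langle 0,2n-1\rangle$ such that $M_{s+1}$ is a flip of $M_s$ for $1\le s<n$ and $M_n=M_1(-1)$. *)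

(* Defs.v *)
From mathcomp Require Import all_boot all_order all_algebra.

Set Implicit Arguments.
Unset Strict Implicit.
Unset Printing Implicit Defensive.

(* Matchings are sets of pairs, hence sets of 2-element sets. *)
Definition matching (n : nat) (M : {set {set 'I_(2 * n)}}) : bool :=
  partition M [set: 'I_(2 * n)] && [forall B in M, #|B| == 2].

Definition noncrossing (n : nat) (M : {set {set 'I_(2 * n)}}) : bool :=
  ~~ [exists i : 'I_(2 * n), exists j : 'I_(2 * n),
      exists k : 'I_(2 * n), exists l : 'I_(2 * n),
      [&& i < j, j < k, k < l, [set i; k] \in M & [set j; l] \in M]].

(* "Two pairs" means two different pairs.  As i, j (and k, l) may be swapped,
   both ways of re-pairing the four points are covered. *)
Definition is_flip (n : nat) (M M' : {set {set 'I_(2 * n)}}) : bool :=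
  [exists i : 'I_(2 * n), exists j : 'I_(2 * n),
   exists k : 'I_(2 * n), exists l : 'I_(2 * n),
   [&& [set i; j] \in M, [set k; l] \in M, [set i; j] != [set k; l]
     & M' == (M :\: [set [set i; j]; [set k; l]])
             :|: [set [set i; l]; [set j; k]]]].

(* The matching M(-1); [ord_pred] is subtraction of 1 modulo 2n. *)
Definition shift (n : nat) (M : {set {set 'I_(2 * n)}}) :
    {set {set 'I_(2 * n)}} :=
  [set [set ord_pred i | i in B] | B : {set 'I_(2 * n)} in M].

(* The default value set0 of [head] and [last] is irrelevant for n > 0. *)
Definition necklace (n : nat) (t : n.-tuple {set {set 'I_(2 * n)}}) : bool :=
  [&& all (fun M => matching M && noncrossing M) t,
      sorted (@is_flip n) t
    & last set0 t == shift (head set0 t)].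

(* Main.v *)
(* A matching on 2n points whose pairs join points of opposite parity is a
   permutation f of 'I_n, pairing 2i with 2 f(i) + 1. Let l be the length with
   respect to transpositions and C the cycle i |-> i - 1. Then f is noncrossing
   iff l(f) + l(f^-1 C) = n - 1, flips are multiplications by transpositions,
   and M(-1) corresponds to f^-1 C.

   Let t_1, ..., t_(n-1) be transpositions, each of them marked left or right,
   with L the product of the left ones, R that of the right ones, and L R = C.
   Starting from A = L, a left letter t acts by A |-> t A, a right one by
   A |-> A t; all permutations on the way are middle segments of the word L R,
   hence noncrossing, and the walk ends at R = L^-1 C: this is a necklace. The
   word is recovered from the walk, as left letters shorten A and right ones
   lengthen it. Every necklace arises: its permutations form a geodesic from A
   to A^-1 C, and on such a geodesic a right letter can be moved behind the left
   letters which follow it, so that the left letters alone take A to 1.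

   There remains to count marked words of transpositions with L R = C.
   Building them one letter at a time, weighted by the product of the cycle
   lengths of L R, each letter that merges two cycles of a permutation with k
   cycles multiplies the total weight by 2 n (k - 1). This gives the number of
   words whose product is any n-cycle, and all n-cycles are conjugate. *)

Require Import Defs.
From mathcomp Require Import all_boot all_order all_algebra.
From mathcomp Require Import fingroup perm.
From mathcomp Require Import zify ring.

Set Implicit Arguments.
Unset Strict Implicit.
Unset Printing Implicit Defensive.

Import GRing.Theory Num.Theory.
Local Open Scope group_scope.

(** * Transposition length *)

(* The least number of transpositions with product g. *)
Definition rlen (T : finType) (g : {perm T}) := #|T| - #|porbits g|.

(* The products of permutations inside [rlen] may carry different, convertible
   group structures, which [lia] would treat as different atoms. *)
Ltac rlia :=
  repeat match goal with
  | H : context [rlen _] |- _ => move: H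
  end;
  repeat match goal with
  | |- context [rlen ?g] => move: (rlen g) => ?
  end;
  lia.

Section ReflectionLength.
Variable T : finType.
Implicit Types (g h s p k t : {perm T}) (a b x y z : T).

(** The orbit partition of [g] refines that of [h]. One step of [g] is enough to ask for, since
    orbits are closed under steps. *)
Definition finer g h := forall x, g x \in porbit h x.

Lemma porbits_le_card g : #|porbits g| <= #|T|.
Proof. exact: leq_imset_card. Qed.

Lemma rlen_porbits g : rlen g + #|porbits g| = #|T|.
Proof. by rewrite subnK ?porbits_le_card. Qed.

Lemma porbit_trans g x y z :
  y \in porbit g x -> z \in porbit g y -> z \in porbit g x.
Proof. by rewrite -!(eq_porbit_mem g) => /eqP-> /eqP->. Qed.

Lemma porbit_step g x : g x \in porbit g x.
Proof. exact: (mem_porbit g 1). Qed.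

Lemma porbit_inv_step g x : g^-1 x \in porbit g x.
Proof. by rewrite -porbitV porbit_step. Qed.

Lemma porbit_sub_closed g (S : pred T) x y :
  (forall u, S u -> S (g u)) -> S x -> y \in porbit g x -> S y.
Proof.
move=> gS Sx /porbitP[i ->]; elim: i => [|i IHi]; first by rewrite perm1.
by rewrite expgSr permM gS.
Qed.

Lemma finer_porbit g h x y :
  finer g h -> y \in porbit g x -> y \in porbit h x.
Proof.
move=> cgh; apply: (porbit_sub_closed (S := fun u => u \in porbit h x)) => [u|].
  by move=> hu; apply: porbit_trans hu (cgh u).
exact: porbit_id.
Qed.

Lemma finer_refl g : finer g g. Proof. exact: porbit_step. Qed.

Lemma finer_trans g h s : finer g h -> finer h s -> finer g s.
Proof. by move=> gh hs x; apply: finer_porbit hs _. Qed.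

Lemma finerV g h : finer g h -> finer g^-1 h.
Proof. by move=> gh x; apply: finer_porbit gh (porbit_inv_step g x). Qed.

Lemma finerM g h s : finer g s -> finer h s -> finer (g * h) s.
Proof. by move=> gs hs x; rewrite permM; apply: porbit_trans (gs x) (hs _). Qed.

Lemma finer_tperm a b s : b \in porbit s a -> finer (tperm a b) s.
Proof.
move=> ab x; case: tpermP => [->|->|_ _] //; last exact: porbit_id.
by rewrite porbit_sym.
Qed.

(** An orbit of [tperm a b * g] can leave a [g]-orbit only at [a] or [b], so at most the orbits of
    these two points get linked. *)
Lemma porbit_tpermM a b g x y :
  y \in porbit (tperm a b * g) x ->
  [|| y \in porbit g x, (x \in porbit g a) && (y \in porbit g b)
    | (x \in porbit g b) && (y \in porbit g a)].
Proof.
apply: (porbit_sub_closed (S := fun y => [|| y \in porbit g x,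
  (x \in porbit g a) && (y \in porbit g b)
  | (x \in porbit g b) && (y \in porbit g a)])); last by rewrite porbit_id.
have gE z u : (g u \in porbit g z) = (u \in porbit g z).
  by have := porbit_perm g 1 u; rewrite expg1 !(porbit_sym _ _ z) => ->.
move=> u; rewrite permM !gE.
case: tpermP => [->|->|_ _] //;
  rewrite !porbit_id !andbT (porbit_sym g a x) (porbit_sym g b x);
  by do 2!case: (x \in porbit g _); rewrite ?orbT.
Qed.

Lemma rlen_tpermM_join a b g :
  b \notin porbit g a -> rlen (tperm a b * g) = (rlen g).+1.
Proof.
move=> nab; have := porbits_mul_tperm g a b; rewrite /= porbit_sym nab.
have -> : a != b by apply: contraNneq nab => <-; apply: porbit_id.
have := rlen_porbits (tperm a b * g); have := rlen_porbits g.
by rewrite /= -muln2; lia.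
Qed.

Lemma rlen_tpermM_split a b g :
  a != b -> b \in porbit g a -> (rlen (tperm a b * g)).+1 = rlen g.
Proof.
move=> ab gab; have := porbits_mul_tperm g a b; rewrite /= porbit_sym gab ab.
have := rlen_porbits (tperm a b * g); have := rlen_porbits g.
by rewrite /=; lia.
Qed.

Lemma rlen_tpermM_le a b g : rlen (tperm a b * g) <= (rlen g).+1.
Proof.
have [gab|gab] := boolP (b \in porbit g a); last by rewrite rlen_tpermM_join.
have [->|ab] := eqVneq a b; first by rewrite tperm1 mul1g.
by have := rlen_tpermM_split ab gab; lia.
Qed.

Lemma tpermM_joinP a b g :
  a != b -> (rlen (tperm a b * g) == (rlen g).+1) = (b \notin porbit g a).
Proof.
move=> ab; have [gab|gab] := boolP (b \in porbit g a).
  by have := rlen_tpermM_split ab gab; lia.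
by rewrite rlen_tpermM_join ?eqxx.
Qed.

Lemma porbit_tpermM_joined a b g :
  b \notin porbit g a -> finer g (tperm a b * g) /\
  b \in porbit (tperm a b * g) a.
Proof.
move=> gab; set h := _ * g.
have ab : a != b by apply: contraNneq gab => <-; apply: porbit_id.
have hab : b \in porbit h a.
  (* Otherwise a second factor [tperm a b] would lengthen once more, although it restores [g]. *)
  apply: contraT => nab; have := rlen_tpermM_join nab.
  by rewrite /h mulgA tperm2 mul1g rlen_tpermM_join //; lia.
split=> //; have -> : g = tperm a b * h by rewrite /h mulgA tperm2 mul1g.
rewrite {2}/h -/h; apply: finerM (finer_refl h).
exact: finer_tperm.
Qed.

Lemma rlen1 : rlen (1 : {perm T}) = 0.
Proof.
rewrite /rlen card_imset ?subnn // => x y /eqP; rewrite eq_porbit_mem.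
by rewrite porbit.unlock cycle1 imset_set1 /aperm perm1 inE => /eqP.
Qed.

Lemma rlenV g : rlen g^-1 = rlen g.
Proof. by rewrite /rlen porbitsV. Qed.

Lemma rlen_moved g x :
  g x != x -> (rlen (tperm x (g x) * g)).+1 = rlen g.
Proof.
by move=> gx; rewrite rlen_tpermM_split ?porbit_step // eq_sym.
Qed.

Lemma perm_moved g : g != 1 -> exists x, g x != x.
Proof.
move=> g1; apply/existsP; apply: contraNT g1 => /existsPn g1.
by apply/eqP/permP => x; rewrite perm1; apply/eqP; have := g1 x; rewrite negbK.
Qed.

(** Induction along a reduced word: for a moved point [x], the transposition of [x] and [g x] splits
    a cycle and so shortens [g]. *)
Lemma rlen_ind (P : {perm T} -> Prop) :
  P 1 ->
  (forall a b g, a != b -> rlen (tperm a b * g) = (rlen g).+1 ->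
     P g -> P (tperm a b * g)) ->
  forall g, P g.
Proof.
move=> P1 PM g; have [k] := ubnP (rlen g); elim: k g => // k IHk g.
have [-> //|/perm_moved[x gx]] := eqVneq g 1.
have lg := rlen_moved gx; move=> gk.
have gE : g = tperm x (g x) * (tperm x (g x) * g) by rewrite mulgA tperm2 mul1g.
by rewrite gE; apply: PM; [rewrite eq_sym | rewrite -gE -lg | apply: IHk; rlia].
Qed.

Lemma rlen0 g : rlen g = 0 -> g = 1.
Proof. by elim/rlen_ind: g => // a b g _ ->. Qed.

Lemma rlen_tperm a b : a != b -> rlen (tperm a b) = 1%N.
Proof.
move=> ab; rewrite -[tperm a b]mulg1 rlen_tpermM_join ?rlen1 //.
by rewrite porbit.unlock cycle1 imset_set1 /aperm perm1 inE eq_sym.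
Qed.

Lemma rlen1P g : rlen g = 1%N -> exists a b, a != b /\ g = tperm a b.
Proof.
elim/rlen_ind: g => [|a b g ab -> _ [/rlen0->]]; first by rewrite rlen1.
by exists a, b; rewrite mulg1.
Qed.

Lemma rlen_subadd g h : rlen (g * h) <= rlen g + rlen h.
Proof.
elim/rlen_ind: g => [|a b g ab lg IHg]; first by rewrite mul1g rlen1.
by rewrite lg -mulgA; have := rlen_tpermM_le a b (g * h); rlia.
Qed.

Lemma rlenJ g h : rlen (g ^ h) = rlen g.
Proof.
suffices le (u v : {perm T}) : rlen (u ^ v) <= rlen u.
  by apply/eqP; rewrite eqn_leq le -{1}(conjgK h g) le.
elim/rlen_ind: u => [|a b u ab lu IHu]; first by rewrite conj1g rlen1.
rewrite conjMg tpermJ; have := rlen_tpermM_le (v a) (v b) (u ^ v).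
by rewrite lu; rlia.
Qed.

Lemma rlenC g h : rlen (g * h) = rlen (h * g).
Proof. by rewrite -(rlenJ _ g) conjgE mulgA mulKg. Qed.

Lemma rlen_involution g : rlen g = 1%N -> g * g = 1.
Proof. by case/rlen1P=> a [b [_ ->]]; apply: tperm2. Qed.

(** When lengths add up, each letter of a reduced word of [g] put in front of [h] merges two orbits,
    so orbits only grow. *)
Lemma finer_mul g h :
  rlen (g * h) = rlen g + rlen h -> finer g (g * h) /\ finer h (g * h).
Proof.
suffices main : rlen (g * h) = rlen g + rlen h -> finer g (g * h).
  move/main => cg; split=> //.
  by have := finerM (finerV cg) (finer_refl (g * h)); rewrite mulKg.
elim/rlen_ind: g => [|a b g ab lg IHg].
  by move=> _ x; rewrite perm1 porbit_id.
rewrite -mulgA lg => lgh.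
have lgh' : rlen (g * h) = rlen g + rlen h.
  by have := rlen_tpermM_le a b (g * h); have := rlen_subadd g h; rlia.
have nab : b \notin porbit (g * h) a by rewrite -tpermM_joinP // lgh lgh'.
have [cgh jab] := porbit_tpermM_joined nab.
apply: finerM (finer_tperm jab) _.
exact: finer_trans (IHg lgh') cgh.
Qed.

(* Lengths add up iff the transpositions in reduced words of [g] and [h] form
   a forest, a condition which does not depend on their order. *)
Lemma rlen_mulV g h :
  rlen (g * h) = rlen g + rlen h ->
  [/\ rlen (g^-1 * h) = rlen g + rlen h, finer (g * h) (g^-1 * h)
    & finer (g^-1 * h) (g * h)].
Proof.
elim/rlen_ind: g => [|a b g ab lg IHg].
  by rewrite invg1 !mul1g => lh; split=> //; exact: finer_refl.
rewrite -mulgA lg => lgh.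
have lgh' : rlen (g * h) = rlen g + rlen h.
  by have := rlen_tpermM_le a b (g * h); have := rlen_subadd g h; rlia.
have nab : b \notin porbit (g * h) a by rewrite -tpermM_joinP // lgh lgh'.
have [cgh _] := finer_mul lgh'.
have [lV c1 c2] := IHg lgh'.
have -> : (tperm a b * g)^-1 * h = tperm (g a) (g b) * (g^-1 * h).
  by rewrite invMg tpermV -tpermJ conjgE !mulgA mulgK.
have nab' : g b \notin porbit (g^-1 * h) (g a).
  apply: contra nab => /(finer_porbit c2) gab.
  apply: porbit_trans (cgh a) (porbit_trans gab _).
  by rewrite porbit_sym cgh.
have [d1 j1] := porbit_tpermM_joined nab.
have [d2 j2] := porbit_tpermM_joined nab'.
have e1 := finer_trans c1 d2; have e2 := finer_trans c2 d1.
have f1 := finer_trans cgh e1; have f2 := finer_trans cgh d1.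
split; first by rewrite rlen_tpermM_join // lV.
  apply: finerM e1; apply: finer_tperm.
  apply: porbit_trans (f1 a) (porbit_trans j2 _).
  by rewrite porbit_sym f1.
apply: finerM e2; apply: finer_tperm.
apply: porbit_trans (porbit_trans j1 (f2 b)).
by rewrite porbit_sym f2.
Qed.


(* With [t1 = p t p^-1 = (a b)], the permutation [H = k t p^-1] separates [a]
   from [b], while the orbits of both [p] and [u] lie inside those of [H]; as
   the orbits of [u] also lie in those of [t1 p], they lie in those of [p]. *)
Lemma rlen_exchange p k t (u : {perm T}) :
  rlen (p * k) = rlen p + rlen k -> rlen t = 1%N ->
  rlen (p * t) = (rlen p).+1 -> (rlen (t * k)).+1 = rlen k ->
  rlen (u^-1 * (p * t)) + rlen u = (rlen p).+1 ->
  (rlen (k * (u^-1 * (p * t))^-1) + rlen u).+1 <= rlen (p * k) ->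
  rlen (u^-1 * p) + rlen u = rlen p.
Proof.
move=> lxk /rlen1P[a' [b' [ab' tE]]] lxt ltk lu ldist.
pose a := p^-1 a'; pose b := p^-1 b'.
have ab : a != b by rewrite (inj_eq perm_inj).
have tx : p * t = tperm a b * p.
  by rewrite tE -(permKV p a') -(permKV p b') -tpermJ conjgE !mulgA mulgV mul1g.
have tt : t * t = 1 by rewrite tE tperm2.
pose H := k * t * p^-1.
have HG : k * p^-1 = H * tperm a b.
  have -> : tperm a b = p * t * p^-1 by rewrite tx mulgK.
  by rewrite /H !mulgA mulgKV -[k * t * t]mulgA tt mulg1.
have [lG _ _] := rlen_mulV lxk; rewrite rlenC HG in lG.
have Hu : H * u = k * (u^-1 * (p * t))^-1.
  by rewrite /H !invMg invgK tE tpermV !mulgA.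
have Hu' : H = (H * u) * u^-1 by rewrite mulgK.
have lH1 := rlen_subadd (H * u) u^-1; rewrite -Hu' rlenV Hu in lH1.
have lH2 := rlen_subadd H (tperm a b); rewrite (rlen_tperm ab) in lH2.
have lH3 := rlen_subadd (k * t) p^-1; rewrite -/H rlenC rlenV in lH3.
(* [lH2] and [lH3] pin [rlen H] to one less than [rlen p + rlen k], so [tperm a b] joins two orbits
   of [H]. *)
have nab : b \notin porbit H a.
  by rewrite -tpermM_joinP // rlenC; apply/eqP; rlia.
have [_ uH] : finer (H * u) H /\ finer u^-1 H.
  by rewrite {2 3}Hu'; apply: finer_mul; rewrite -Hu' Hu rlenV; rlia.
have {}uH := finerV uH; rewrite invgK in uH.
have [_ xH] : finer (k * t) H /\ finer p^-1 H.
  by apply: finer_mul; rewrite -/H [rlen (k * t)]rlenC rlenV; rlia.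
have {}xH := finerV xH; rewrite invgK in xH.
have [ut _] : finer u (p * t) /\ finer (u^-1 * (p * t)) (p * t).
  rewrite -{1 3}[p * t](mulKVg u); apply: finer_mul; rewrite mulKVg; rlia.
have nabx : b \notin porbit p a.
  by rewrite -tpermM_joinP // -tx lxt.
have ux : finer u p.
  move=> z; have := ut z; rewrite tx => /porbit_tpermM.
  case/or3P=> // /andP[za zb]; case/negP: nab.
    apply: porbit_trans (finer_porbit xH za) (porbit_trans (uH z) _).
    by rewrite porbit_sym; apply: finer_porbit xH _.
  apply: porbit_trans (finer_porbit xH zb) _.
  rewrite porbit_sym; apply: porbit_trans (uH z).
  exact: finer_porbit xH _.
have uxx : finer (u^-1 * p) p := finerM (finerV ux) (finer_refl p).
have uE : u^-1 * (p * t) = tperm (u a) (u b) * (u^-1 * p).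
  by rewrite tx -tpermJ conjgE !mulgA mulgK.
rewrite uE rlen_tpermM_join in lu; first by rlia.
apply: contra nabx => /(finer_porbit uxx) uab.
by apply: porbit_trans (ux a) (porbit_trans uab _); rewrite porbit_sym ux.
Qed.

End ReflectionLength.

(** * Marked words and their walks *)

Section SignedWords.
Variables (T : finType) (C : {perm T}).
Implicit Types (A B X D t : {perm T}) (a : bool * {perm T}).
Implicit Types (s : seq (bool * {perm T})) (r : seq {perm T}).

Definition word s := all (fun a => rlen a.2 == 1%N) s.
Definition lprod s := \prod_(a <- s | a.1) a.2.
Definition rprod s := \prod_(a <- s | ~~ a.1) a.2.
Definition lcount s := count (fun a => a.1) s.
Definition rcount s := count (fun a => ~~ a.1) s.

Definition step A a := if a.1 then a.2 * A else A * a.2.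
(** The Kreweras complement; [nc] below says that [A] lies on a geodesic from 1 to [C]. *)
Definition kreweras A := A^-1 * C.
Definition nc A := rlen A + rlen (kreweras A) == rlen C.
Definition flip_perm A B := rlen (B * A^-1) == 1%N.

(** Marks agree with the change of length, left for shorter and right for longer. This is what lets
    a walk determine its word. *)
Fixpoint valid A s :=
  if s is a :: s' then (a.1 == (rlen (step A a) < rlen A)) && valid (step A a)
    s'
  else true.

Definition decode1 A B :=
  if rlen B < rlen A then (true, B * A^-1) else (false, A^-1 * B).

Lemma rlen_mul1 t A : rlen t = 1%N ->
  rlen (t * A) = (rlen A).+1 \/ rlen A = (rlen (t * A)).+1.
Proof.
case/rlen1P=> a [b [ab ->]]; have [gab|gab] := boolP (b \in porbit A a).
  by right; rewrite rlen_tpermM_split.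
by left; rewrite rlen_tpermM_join.
Qed.

Lemma invol_V t : rlen t = 1%N -> t^-1 = t.
Proof. by move=> /rlen_involution tt; rewrite -[RHS](mulKg t) tt mulg1. Qed.

Lemma rlen_lprod s : word s -> rlen (lprod s) <= lcount s.
Proof.
rewrite /lprod; elim: s => [|[b t] s IHs] /=; first by rewrite big_nil rlen1.
case/andP=> /eqP lt /IHs ls; rewrite big_cons; case: b => //=.
by have := rlen_subadd t (\prod_(a <- s | a.1) a.2); rlia.
Qed.

Lemma rlen_rprod s : word s -> rlen (rprod s) <= rcount s.
Proof.
rewrite /rprod; elim: s => [|[b t] s IHs] /=; first by rewrite big_nil rlen1.
case/andP=> /eqP lt /IHs ls; rewrite big_cons; case: b => //=.
by have := rlen_subadd t (\prod_(a <- s | ~~ a.1) a.2); rlia.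
Qed.

Lemma lcount_rcount s : lcount s + rcount s = size s.
Proof. exact: count_predC. Qed.

(** Left letters pile up in reverse order; being involutions, they multiply to [(lprod s)^-1]. *)
Lemma last_walk A s : word s ->
  last A (scanl step A s) = (lprod s)^-1 * A * rprod s.
Proof.
rewrite /lprod /rprod; elim: s A => [|[b t] s IHs] A /=.
  by rewrite !big_nil invg1 mul1g mulg1.
case/andP=> /eqP lt /IHs ->; rewrite !big_cons /step; case: b => /=.
  by rewrite invMg (invol_V lt) !mulgA.
by rewrite !mulgA.
Qed.

Lemma lprod_cons b t s : lprod ((b,
  t) :: s) = if b then t * lprod s else lprod s.
Proof. by rewrite /lprod big_cons. Qed.

Lemma rprod_cons b t s : rprod ((b,
  t) :: s) = if b then rprod s else t * rprod s.
Proof. by rewrite /rprod big_cons; case: b. Qed.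

(* Every permutation on the walk is a middle segment of the factorization
   [X * (lprod s * D) * rprod s] of [C]. *)
Lemma segment_rlen X D s x d : word s ->
  X * (lprod s * D) * rprod s = C -> rlen X <= x -> rlen D <= d ->
  x + d + size s <= rlen C ->
  nc (lprod s * D) /\ rlen (lprod s * D) = lcount s + d.
Proof.
move=> ws CE lX lD lC; set A := lprod s * D.
have lA : rlen A <= lcount s + d.
  by have := rlen_subadd (lprod s) D; have := rlen_lprod ws; rewrite /A; rlia.
have lK : rlen (kreweras A) <= x + rcount s.
  have -> : kreweras A = X ^ A * rprod s by rewrite /kreweras -CE conjgE !mulgA.
  have := rlen_subadd (X ^ A) (rprod s); rewrite rlenJ.
  by have := rlen_rprod ws; rlia.
have := rlen_subadd A (kreweras A); rewrite {2}/kreweras mulKVg.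
by have := lcount_rcount s; rewrite /nc; split; rlia.
Qed.

(** Reading a left letter moves it from the segment into [X], reading a right one moves it from
    [rprod] into [D]. The length budget [x + d + size s] is kept, and [segment_rlen] gives the exact
    length before and after, hence the mark. *)
Lemma walk_segments X D s x d : word s ->
  X * (lprod s * D) * rprod s = C -> rlen X <= x -> rlen D <= d ->
  x + d + size s <= rlen C ->
  all nc (scanl step (lprod s * D) s) && valid (lprod s * D) s.
Proof.
elim: s X D x d => [|[b t] s IHs] X D x d // ws CE lX lD lC.
have [_ lA] := segment_rlen ws CE lX lD lC.
move: ws => /= /andP[/eqP /= lt ws].
have stepE : step (lprod ((b, t) :: s) * D) (b, t)
    = lprod s * (if b then D else D * t).
  rewrite lprod_cons /step; case: (b) => /=; last by rewrite mulgA.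
  by rewrite !mulgA (rlen_involution lt) mul1g.
pose X' := if b then X * t else X.
have CE' : X' * (lprod s * (if b then D else D * t)) * rprod s = C.
  by rewrite -CE lprod_cons rprod_cons /X'; case: (b); rewrite !mulgA.
have lX' : rlen X' <= x + b.
  by rewrite /X'; case: (b); have := rlen_subadd X t; rlia.
have lD' : rlen (if b then D else D * t) <= d + ~~ b.
  by case: (b); have := rlen_subadd D t; rlia.
have lC' : x + b + (d + ~~ b) + size s <= rlen C.
  by move: lC => /=; case: (b) => /=; rlia.
rewrite stepE; have [-> lB] := segment_rlen ws CE' lX' lD' lC'.
have /andP[-> ->] := IHs _ _ _ _ ws CE' lX' lD' lC'; rewrite andbT /=.
by rewrite lA lB /lcount /=; case: (b) => /=; apply/eqP; lia.
Qed.

Lemma pflip_step A a : rlen a.2 = 1%N -> flip_perm A (step A a).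
Proof.
move=> lt; rewrite /flip_perm /step; case: a.1; first by rewrite mulgK lt.
by rewrite rlenC mulKg lt.
Qed.

Lemma sorted_walk A s : word s -> path flip_perm A (scanl step A s).
Proof.
elim: s A => //= a s IHs A /andP[/eqP lt ws].
by rewrite pflip_step //= IHs.
Qed.

Definition necklace_perm r :=
  [&& all nc r, sorted flip_perm r & last 1 r == kreweras (head 1 r)].

Definition walk s := lprod s :: scanl step (lprod s) s.

Lemma walk_factorization s : word s -> lprod s * rprod s = C ->
  size s = rlen C ->
  necklace_perm (walk s) /\ valid (lprod s) s.
Proof.
move=> ws CE lC.
have CE' : 1 * (lprod s * 1) * rprod s = C by rewrite mul1g mulg1.
have lC' : 0 + 0 + size s <= rlen C by rewrite lC.
have l0 : rlen (1 : {perm T}) <= 0 by rewrite rlen1.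
have [ncA _] := segment_rlen ws CE' l0 l0 lC'.
have := walk_segments ws CE' l0 l0 lC';
  rewrite !mulg1 in ncA * => /andP[ncw ->].
split=> //; rewrite /necklace_perm /= ncA ncw sorted_walk //= last_walk //.
by rewrite mulVg mul1g /kreweras -CE mulKg.
Qed.

(** Validity fixes each mark, and cancellation in the group then fixes the transposition. *)
Lemma scanl_step_inj A s s' : valid A s -> valid A s' ->
  scanl step A s = scanl step A s' -> s = s'.
Proof.
elim: s s' A => [|[b t] s IHs] [|[b' t'] s'] A //=.
case/andP=> /eqP bE vs /andP[/eqP bE' vs'] [sE].
rewrite -sE in vs' bE' * => /IHs-> //; congr (_ :: _).
have bb : b' = b := etrans bE' (esym bE).
rewrite bb in sE *; congr (_, _).
by move: sE; rewrite /step /=; case: (b) => [/mulIg|/mulgI].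
Qed.

Lemma decodeP A r : path flip_perm A r ->
  let s := pairmap decode1 A r in
  [/\ word s, valid A s & scanl step A s = r].
Proof.
elim: r A => [|B r IHr] A //= /andP[AB /IHr[ws vs sE]].
have stepE : step A (decode1 A B) = B.
  by rewrite /decode1; case: ifP => _; rewrite /step /= ?mulgKV ?mulKVg.
rewrite stepE sE vs ws !andbT; split=> //; last by rewrite /decode1; case: ifP.
rewrite /decode1; case: ifP => _ //=.
by rewrite rlenC.
Qed.

Lemma valid_rlen A s : word s -> valid A s ->
  rlen (last A (scanl step A s)) + lcount s = rlen A + rcount s.
Proof.
elim: s A => [|[b t] s IHs] A //= /andP[/eqP lt ws] /andP[/eqP bE vs].
have {IHs vs} := IHs _ ws vs; move: bE; rewrite /step /lcount /rcount /=.
case: b => /=; first by case: (rlen_mul1 A lt); rlia.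
by rewrite -(rlenC t); case: (rlen_mul1 A lt); rlia.
Qed.

Lemma nc_permP A : reflect (rlen A + rlen (kreweras A) = rlen C) (nc A).
Proof. exact: eqP. Qed.

(** [C] cancels and length is invariant under conjugation. Hence one step of the walk moves the
    target [kreweras A] by one only. *)
Lemma kreweras_dist A B : rlen (kreweras A * (kreweras B)^-1) = rlen (B * A^-1).
Proof. by rewrite /kreweras !invMg invgK !mulgA mulgK rlenC. Qed.

(* The distance from [A] to [kreweras A] is [rlen C]: a walk which ends close
   enough to [kreweras A] is geodesic, and its shrinking letters can be moved to
   the front. *)
Lemma shrinking_part A s : word s -> valid A s ->
  all nc (A :: scanl step A s) ->
  rlen (kreweras A * (last A (scanl step A s))^-1) + size s <= rlen C ->
  rlen ((lprod s)^-1 * A) + lcount s = rlen A.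
Proof.
elim: s A => [|[b t] s IHs] A.
  by rewrite /lprod /lcount big_nil /= invg1 mul1g !addn0.
move=> /= /andP[/eqP lt ws] /andP[/eqP bE vs] /and3P[/nc_permP ncA /nc_permP
  ncB ncs].
set B := step A (b, t) in bE vs ncB ncs *.
set Z := last B _ => lC.
have AB : rlen (kreweras B * (kreweras A)^-1) = 1%N.
  rewrite kreweras_dist -(rlenV (A * B^-1)) invMg invgK.
  by apply/eqP; exact: (pflip_step A (a := (b, t)) lt).
have lB : rlen (kreweras B * Z^-1) + size s <= rlen C.
  have := rlen_subadd (kreweras B * (kreweras A)^-1) (kreweras A * Z^-1).
  by rewrite mulgA mulgKV; rlia.
have ncBs : all nc (B :: scanl step B s) by rewrite /= ncs andbT;
  apply/nc_permP.
have {}IHs := IHs _ ws vs ncBs lB.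
have BE : B = if b then t * A else A * t by [].
rewrite lprod_cons /lcount /= -[count _ s]/(lcount s).
(* A left letter simply extends [lprod s]. A right letter lengthens [A] and shortens [kreweras A];
   [rlen_exchange] moves it behind the left letters. *)
move: bE BE; case bb: b => bE BE.
  have := IHs; rewrite BE in bE *; rewrite invMg (invol_V lt) mulgA.
  by case: (rlen_mul1 A lt); rlia.
have lAt : rlen (A * t) = (rlen A).+1.
  by rewrite BE in bE; case: (rlen_mul1 A lt) bE; rewrite [rlen (A * t)]rlenC;
    rlia.
have AK : A * kreweras A = C by rewrite /kreweras mulKVg.
have tK : kreweras B =
  t * kreweras A by rewrite BE /kreweras invMg (invol_V lt) mulgA.
rewrite tK BE lAt in ncB; rewrite BE lAt in IHs.
have lu : rlen (lprod s) = lcount s.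
  have := rlen_lprod ws; have := rlen_subadd (lprod s) ((lprod s)^-1 * (A * t)).
  by rewrite mulKVg; rlia.
rewrite add0n -lu; apply: (@rlen_exchange _ _ (kreweras A) t).
- by rewrite AK ncA.
- by [].
- by [].
- by rlia.
- by rewrite lu.
rewrite AK; have ZE : Z =
  (lprod s)^-1 * (A * t) * rprod s by rewrite /Z last_walk // BE.
(* The detour through the endpoint [Z] costs at most the right letters of [s], since [Z] differs
   from [(lprod s)^-1 * (A * t)] by [rprod s]. *)
have := rlen_subadd (kreweras A * Z^-1) (Z * ((lprod s)^-1 * (A * t))^-1).
rewrite mulgA mulgKV {2}ZE [rlen (_ * _ * rprod s * _)]rlenC mulKg.
by have := rlen_rprod ws; have := lcount_rcount s; rlia.
Qed.

Lemma factorization_walk A s : word s -> valid A s -> size s = rlen C ->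
  necklace_perm (A :: scanl step A s) -> lprod s = A /\ lprod s * rprod s = C.
Proof.
move=> ws vs lC /and3P[ncs _ /eqP /= lastE].
have /nc_permP lA : nc A by case/andP: ncs.
have := shrinking_part ws vs ncs;
  rewrite lastE mulgV rlen1 lC => /(_ (leqnn _)) lu.
have := valid_rlen ws vs; rewrite lastE; have := lcount_rcount s => sE lE.
(* [lE], [lA] and [sE] force [rlen A = lcount s], so the left letters, which shorten [A] by
   [lcount s], bring it to 1. *)
have /rlen0 uA : rlen ((lprod s)^-1 * A) = 0 by rlia.
have AE : lprod s = A by rewrite -[RHS](mulKVg (lprod s)) uA mulg1.
split=> //; have := last_walk A ws; rewrite lastE uA mul1g => <-.
by rewrite AE /kreweras mulKVg.
Qed.

End SignedWords.

(** * Counting marked words *)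

Section Merging.
Variable T : finType.
Implicit Types (g h p t : {perm T}) (a b x y z : T).

Lemma porbit_eq g x y : y \in porbit g x -> porbit g y = porbit g x.
Proof. by move=> gy; apply/esym/eqP; rewrite eq_porbit_mem porbit_sym. Qed.

Lemma porbits_joinE g a b : b \notin porbit g a ->
  porbits (tperm a b * g) =
  (porbit g a :|: porbit g b) |: (porbits g :\ porbit g a :\ porbit g b).
Proof.
move=> nab; set h := tperm a b * g; set AB := porbit g a :|: porbit g b.
have [gh hab] : finer g h /\ b \in porbit h a := porbit_tpermM_joined nab.
have hAB x : x \in AB -> porbit h x = AB.
  have hAB1 : porbit h a = AB.
    apply/setP => y; apply/idP/idP => [/porbit_tpermM|].
      rewrite inE => /or3P[->//|/andP[_ ->]|/andP[_ ->]//]; by rewrite orbT.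
    rewrite inE => /orP[/(finer_porbit gh)//|/(finer_porbit gh)].
    exact: porbit_trans.
  move=> xAB; rewrite -hAB1; apply: porbit_eq; by rewrite hAB1.
have hN x : x \notin AB -> porbit h x = porbit g x.
  rewrite inE negb_or => /andP[xa xb]; apply/setP => y; apply/idP/idP.
    by move=> /porbit_tpermM; rewrite (negPf xa) (negPf xb) !orbF.
  exact: finer_porbit.
apply/setP => S; apply/imsetP/idP => [[x _ ->]|].
  have [xAB|xAB] := boolP (x \in AB); first by rewrite hAB // !inE eqxx.
  rewrite hN //; apply/setU1P; right; rewrite !inE imset_f // andbT.
  by move: xAB; rewrite inE negb_or !eq_porbit_mem => /andP[-> ->].
case/setU1P => [->|]; first by exists a; rewrite // hAB // inE porbit_id.
rewrite !inE => /and3P[Sb Sa /imsetP[x _ SE]]; exists x => //.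
by rewrite hN // inE negb_or -!eq_porbit_mem -SE Sa Sb.
Qed.

Local Open Scope ring_scope.

(* The number of ways to root all cycles of g. *)
Definition weight g : rat := \prod_(B in porbits g) #|B|%:R.

Lemma card_porbit_neq0R g x : #|porbit g x|%:R != 0 :> rat.
Proof. by rewrite pnatr_eq0 card_porbit_neq0. Qed.

(** Merging cycles of lengths p and q changes the factor pq into p + q, and (p + q)/(pq) = 1/q +
    1/p. *)
Lemma weight_join g a b : b \notin porbit g a ->
  weight (tperm a b * g)%g
    = weight g * (#|porbit g a|%:R^-1 + #|porbit g b|%:R^-1).
Proof.
move=> nab; rewrite /weight porbits_joinE // big_setU1 /=; last first.
  rewrite !inE; apply/negP => /and3P[_ _ /imsetP[x _ abx]].
  have ax : a \in porbit g x by rewrite -abx inE porbit_id.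
  have bx : b \in porbit g x by rewrite -abx inE porbit_id orbT.
  by move: nab; rewrite (porbit_eq ax) bx.
rewrite [in RHS](big_setD1 (porbit g a)) ?imset_f //=.
rewrite [in RHS](big_setD1 (porbit g b)) /=; last first.
  by rewrite !inE imset_f // andbT eq_porbit_mem.
have -> : #|porbit g a :|: porbit g b| = (#|porbit g a| + #|porbit g b|)%N.
  rewrite cardsU (_ : _ :&: _ = set0) ?cards0 ?subn0 //.
  apply/setP => x; rewrite !inE; apply/negP => /andP[xa xb].
  by move: nab; rewrite -(porbit_eq xa) porbit_sym xb.
rewrite natrD; field.
by rewrite !card_porbit_neq0R.
Qed.

(** The points of each orbit together contribute 1. *)
Lemma sum_card_porbitV g : \sum_a #|porbit g a|%:R^-1 = #|porbits g|%:R :> rat.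
Proof.
rewrite (partition_big (porbit g) (mem (porbits g))) /= => [|a _];
  last exact: imset_f.
rewrite -sumr_const; apply: eq_bigr => B /imsetP[x _ BE].
rewrite (eq_bigr (fun=> #|B|%:R^-1)) => [|a /eqP-> //].
rewrite sumr_const -[RHS](@mulVf _ #|B|%:R) ?BE ?card_porbit_neq0R //.
rewrite mulr_natr; congr (_ *+ _); apply: eq_card => y.
exact: eq_porbit_mem.
Qed.

Lemma sum_join g :
  \sum_a \sum_(b | b \notin porbit g a)
     (#|porbit g a|%:R^-1 + #|porbit g b|%:R^-1)
  = 2 * (#|T|%:R * (#|porbits g|%:R - 1)) :> rat.
Proof.
(* Both summands have the same total by symmetry in [a] and [b]. For fixed [a] there are
   [#|T| - #|porbit g a|] choices of [b], which contribute [#|T| / #|porbit g a| - 1]. *)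
have half : \sum_a \sum_(b | b \notin porbit g a) #|porbit g a|%:R^-1
   = #|T|%:R * (#|porbits g|%:R - 1) :> rat.
  rewrite mulrBr mulr1 -{1}sum_card_porbitV mulr_sumr.
  rewrite (_ : \sum_a _ - _ =
    \sum_a (#|T|%:R * #|porbit g a|%:R^-1 - 1)); last first.
    by rewrite sumrB sumr_const.
  apply: eq_bigr => a _; rewrite sumr_const.
  have -> : #|(fun b => b \notin porbit g a)| = (#|T| - #|porbit g a|)%N.
    by rewrite -(cardC (mem (porbit g a))) addKn; apply: eq_card.
  rewrite mulrnBr ?max_card // -[X in X - _]mulr_natl; congr (_ - _).
  by rewrite -[LHS]mulr_natl mulfV ?card_porbit_neq0R.
have -> : forall x : rat, 2 * x = x + x by move=> x; ring.
rewrite -{1}half -half; under eq_bigr do rewrite big_split /=.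
rewrite big_split /=; congr (_ + _).
rewrite (exchange_big_dep predT) //=; apply: eq_bigr => a _.
by apply: eq_bigl => b; rewrite porbit_sym.
Qed.

Lemma tperm_eq a b x y : a != b -> x != y -> tperm x y = tperm a b ->
  (x, y) = (a, b) \/ (x, y) = (b, a).
Proof.
move=> ab xy E; have := tpermL x y; rewrite E.
by case: tpermP => [-> ->|-> ->|_ _ /eqP]; [left | right | rewrite (negPf xy)].
Qed.

Lemma sum_tperm (F : {perm T} -> rat) :
  \sum_a \sum_(b | a != b) F (tperm a b) = 2 * \sum_(t | rlen t == 1%N) F t.
Proof.
rewrite pair_big_dep /= (partition_big (fun u : T * T => tperm u.1 u.2)
  (fun t => rlen t == 1%N)) /= => [|u /rlen_tperm-> //].
rewrite mulr_sumr; apply: eq_bigr => t /eqP/rlen1P[a [b [ab ->]]].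
rewrite (eq_bigr (fun=> F (tperm a b))) => [|u /andP[_ /eqP-> //]].
rewrite (eq_bigl (mem [set (a, b); (b, a)])) /= => [|[x y]]; last first.
  rewrite !inE /=; apply/andP/orP => [[xy /eqP]|].
    by case/(tperm_eq ab xy) => ->; [left | right].
  by case=> /eqP[-> ->]; split; rewrite // ?(eq_sym b) // tpermC.
rewrite sumr_const cards2 mulr_natl; congr (_ *+ _).
by rewrite xpair_eqE negb_and ab.
Qed.

(** The factor depends only on the number of cycles of [g], which is what makes weighted words
    countable letter by letter. The two marks of a letter later double it. *)
Lemma sum_weight_join g :
  \sum_(t | (rlen t == 1%N) && (rlen (t * g)%g == (rlen g).+1)) weight (t * g)%g
  = weight g * (#|T|%:R * (#|porbits g|%:R - 1)).
Proof.
have two0 : (2 : rat) != 0 by [].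
apply: (mulfI two0); rewrite big_mkcondr /= -sum_tperm mulrCA -sum_join.
rewrite mulr_sumr; apply: eq_bigr => a _.
rewrite mulr_sumr big_mkcond [RHS]big_mkcond; apply: eq_bigr => b _.
have [->|ab] := eqVneq a b; first by rewrite /= porbit_id.
rewrite /= tpermM_joinP //; case: ifP => // nab.
by rewrite weight_join.
Qed.

End Merging.

Section CountingWords.
Variable T : finType.
Notation letter := (bool * {perm T})%type.
Implicit Types (s : seq letter) (C g p t : {perm T}).

Definition wprod s := lprod s * rprod s.

(** A right letter enters in the middle of the product, and conjugation by the left part brings it
    to the front. *)
Lemma wprod_cons b t s :
  wprod ((b, t) :: s) = (if b then t else t ^ (lprod s)^-1) * wprod s.
Proof.
rewrite /wprod lprod_cons rprod_cons; case: b; first by rewrite mulgA.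
by rewrite conjgE invgK !mulgA mulgKV.
Qed.

Lemma rlen_wprod s : word s -> rlen (wprod s) <= size s.
Proof.
move=> ws; rewrite -(lcount_rcount s); apply: leq_trans (rlen_subadd _ _) _.
by apply: leq_add; [apply: rlen_lprod | apply: rlen_rprod].
Qed.

Lemma big_tuple_cons (R : nmodType) (I : finType) k (F : seq I -> R) :
  (\sum_(s : k.+1.-tuple I) F s =
    \sum_(s : k.-tuple I) \sum_(a : I) F (a :: s))%R.
Proof.
rewrite exchange_big pair_big /=.
rewrite (reindex (fun u : I * k.-tuple I => [tuple of u.1 :: u.2])) //=.
exists (fun s : k.+1.-tuple I => (thead s, [tuple of behead s])).
  by case=> a s _ /=; rewrite theadE; congr (_, _); apply: val_inj.
by move=> s _ /=; rewrite -tuple_eta.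
Qed.

Local Open Scope ring_scope.

(** Conjugation permutes the transpositions, so left and right letters contribute equally. *)
Lemma sum_letters s (F : {perm T} -> rat) :
  \sum_(a : letter | rlen a.2 == 1%N) F (wprod (a :: s))
  = 2 * \sum_(t | rlen t == 1%N) F (t * wprod s)%g.
Proof.
rewrite (eq_bigr (fun a : letter => F (wprod ((a.1, a.2) :: s)))) => [|[] //].
rewrite -(pair_big_dep predT (fun _ (t : {perm T}) => rlen t == 1%N)
  (fun b t => F (wprod ((b, t) :: s)))) /=.
rewrite big_bool /=.
have -> : forall x : rat, 2 * x = x + x by move=> x; ring.
congr (_ + _); first by apply: eq_bigr => t _; rewrite wprod_cons.
rewrite [RHS](reindex_inj (conjg_inj (lprod s)^-1%g)) /=.
by apply: eq_big => [t|t _]; rewrite ?rlenJ // wprod_cons.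
Qed.

(** Length [k] for a product of [k] letters means that each letter, prepended in turn, merges two
    cycles. *)
Definition words_weight k : rat :=
  \sum_(s : k.-tuple letter | word s && (rlen (wprod s) == k)) weight (wprod s).

Lemma words_weightS k :
  words_weight k.+1 = words_weight k * (2 * #|T|%:R * (#|T|%:R - k%:R - 1)).
Proof.
rewrite /words_weight big_mkcond.
rewrite (big_tuple_cons k (fun s : seq letter =>
  if word s && (rlen (wprod s) == k.+1)
  then weight (wprod s) else 0)) /=.
rewrite mulr_suml [RHS]big_mkcond; apply: eq_bigr => s _.
rewrite -big_mkcond /=.
have [ws|ws] := boolP (word s); last by rewrite big1 // => a; rewrite andbF.
under eq_bigl do rewrite andbT.
rewrite big_mkcondr /= (sum_letters s (fun g =>
  if rlen g == k.+1 then weight g else 0)).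
(* A tail with a shorter product cannot reach length [k.+1] with one more letter. *)
have [lk|lk] := eqVneq (rlen (wprod s)) k; last first.
  rewrite big1 ?mulr0 // => t /eqP lt; case: eqP => // lt'.
  have := rlen_subadd t (wprod s); have := rlen_wprod ws; rewrite size_tuple.
  by move: lk => /eqP; rlia.
rewrite -big_mkcondr /=; have := sum_weight_join (wprod s); rewrite lk => ->.
have -> : #|porbits (wprod s)|%:R = #|T|%:R - k%:R :> rat.
  by rewrite -[#|T|](rlen_porbits (wprod s)) lk natrD; ring.
ring.
Qed.

Lemma weight1 : weight (1 : {perm T}) = 1.
Proof.
rewrite /weight big1 // => B /imsetP[x _ ->].
by rewrite porbit.unlock cycle1 imset_set1 cards1.
Qed.

(** The factors of [words_weightS] multiply to a falling factorial, kept free of division by the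
    factorial on the left. *)
Lemma words_weightE k : (k < #|T|)%N ->
  words_weight k * (#|T| - k.+1)`!%:R = (2 * #|T|%:R) ^+ k * #|T|.-1`!%:R.
Proof.
elim: k => [|k IHk] kT.
  rewrite expr0 mul1r subn1 /words_weight (big_pred1 [tuple]) => [|s].
    by rewrite /wprod /lprod /rprod !big_nil mulg1 weight1 mul1r.
  rewrite (tuple0 s) /= /wprod /lprod /rprod !big_nil mulg1 rlen1.
  by apply/esym/eqP.
rewrite exprSr mulrAC -IHk 1?ltnW // words_weightS.
have -> : (#|T| - k.+1 = (#|T| - k.+2).+1)%N by lia.
have -> : #|T|%:R = (#|T| - k.+2)%:R + k%:R + 2 :> rat.
  by rewrite -{1}(subnK kT) natrD -[k.+2]addn2 natrD addrA.
by rewrite factS natrM -[(_ - _).+1%:R]natr1; ring.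
Qed.

Lemma porbit_full g x : rlen g = #|T|.-1 -> porbit g x = [set: T].
Proof.
move=> lg; have T0 : (0 < #|T|)%N by apply/card_gt0P; exists x.
have /eqP/cards1P[S SE] : #|porbits g| = 1%N.
  by have := rlen_porbits g; rewrite lg; lia.
apply/setP => y; rewrite inE.
have : porbit g y \in porbits g by rewrite imset_f.
have : porbit g x \in porbits g by rewrite imset_f.
by rewrite SE !inE => /eqP-> /eqP<-; rewrite porbit_id.
Qed.

(** With [#|T|.-1] letters the product is a single full cycle, of weight [#|T|]. *)
Lemma words_count : (0 < #|T|)%N ->
  (#|[set s : (#|T|.-1).-tuple letter | word s && (rlen (wprod s) == #|T|.-1)]|
   * #|T| = (2 * #|T|) ^ #|T|.-1 * #|T|.-1`!)%N.
Proof.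
move=> T0; apply/eqP; rewrite -(eqr_nat rat) natrM.
have := @words_weightE #|T|.-1; rewrite prednK // subnn mulr1 => /(_ (leqnn _)).
rewrite natrM natrX natrM => <-; apply/eqP.
rewrite /words_weight (eq_bigr (fun=> #|T|%:R)) => [|s /andP[_ /eqP ls]].
  by rewrite sumr_const mulr_natl; congr (_ *+ _); apply: eq_card => s;
    rewrite inE.
have [x _] := card_gt0P T0.
rewrite /weight (_ : porbits _ = [set setT]) ?big_set1 ?cardsT //.
apply/setP => S; rewrite inE; apply/imsetP/eqP => [[y _ ->]|->].
  exact: porbit_full.
by exists x; rewrite // porbit_full.
Qed.

(** * Conjugacy of full cycles and factorizations of a fixed one *)

Local Open Scope nat_scope.
Local Open Scope group_scope.

(** The conjugator sends the i-th iterate of [x] under [C] to the i-th iterate of [y] under [p]. *)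
Lemma conj_full C p x y : rlen C = #|T|.-1 -> rlen p = #|T|.-1 ->
  exists2 g, C ^ g = p & g x = y.
Proof.
move=> lC lp; have T0 : 0 < #|T| by apply/card_gt0P; exists x.
have cC : #|porbit C x| = #|T| by rewrite porbit_full // cardsT.
have cp : #|porbit p y| = #|T| by rewrite porbit_full // cardsT.
have uC := uniq_traject_porbit C x; have up := uniq_traject_porbit p y.
rewrite cC in uC; rewrite cp in up.
have mC z : z \in traject C x #|T|.
  by rewrite -cC -porbit_traject porbit_full ?inE.
pose i z := index z (traject C x #|T|).
have iT z : i z < #|T| by rewrite /i -{2}(size_traject C x #|T|) index_mem.
have iE z : iter (i z) C x = z.
  by rewrite -(nth_traject C (iT z)) nth_index.
have gI : injective (fun z => iter (i z) p y).
  move=> z1 z2 /eqP; rewrite -!(nth_traject p (iT _)).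
  by rewrite nth_uniq ?size_traject // => /eqP E; rewrite -[z1]iE E iE.
exists (perm gI); last first.
  rewrite permE /i; case: #|T| T0 => // m _.
  by rewrite /= eqxx.
apply/permP => z; have [u ->] : exists u, z = perm gI u.
  by exists ((perm gI)^-1 z); rewrite permKV.
rewrite permJ !permE.
have CuE : C u = iter (i u).+1 C x by rewrite /= iE.
have [iu|iu] := ltnP (i u).+1 #|T|.
  rewrite [i (C u)](_ : _ = (i u).+1) //.
  rewrite CuE /i -(nth_traject C iu) index_uniq ?size_traject //.
(* At the last point of the trajectory both cycles close up. *)
have {}iu : (i u).+1 = #|T| by apply/eqP; rewrite eqn_leq iT.
have -> : p (iter (i u) p y) = y by rewrite -iterS iu -cp iter_porbit.
rewrite CuE iu -cC iter_porbit /i.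
by case: #|T| T0 => // m _; rewrite /= eqxx.
Qed.

(** A conjugator is determined by the image of one point, which may be arbitrary. *)
Lemma card_conj_full C p : rlen C = #|T|.-1 -> rlen p = #|T|.-1 -> 0 < #|T| ->
  #|[set g | C ^ g == p]| = #|T|.
Proof.
move=> lC lp /card_gt0P[x _].
rewrite -(card_in_imset (f := fun g : {perm T} => g x)) => [|g1 g2].
  rewrite -cardsT; congr #|pred_of_set _|; apply/setP => y; rewrite inE.
  have [g gE <-] := conj_full x y lC lp.
  by apply/imsetP; exists g; rewrite // inE gE.
rewrite !inE => /eqP g1E /eqP g2E g12; apply/permP => z.
have /porbitP[i ->] : z \in porbit C x by rewrite porbit_full ?inE.
have J (g : {perm T}) : g ((C ^+ i) x) = ((C ^ g) ^+ i) (g x).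
  by rewrite -conjXg permJ.
by rewrite !J g1E g2E g12.
Qed.

Definition conj_word g s := [seq (a.1, a.2 ^ g) | a <- s].

Lemma conj_wordP g s : word (conj_word g s) = word s.
Proof. by rewrite /word all_map; apply: eq_all => a /=; rewrite rlenJ. Qed.

Lemma wprod_conj g s : wprod (conj_word g s) = wprod s ^ g.
Proof.
rewrite /wprod conjMg; congr (_ * _); rewrite /lprod /rprod big_map;
by elim/big_rec2: _ => [|a u v _ ->] /=; rewrite ?conj1g ?conjMg.
Qed.

Lemma factorizations_count C : rlen C = #|T|.-1 -> 0 < #|T| ->
  (#|[set s : (#|T|.-1).-tuple letter | word s && (wprod s == C)]| * #|T|
  = (2 * #|T|) ^ #|T|.-1)%N.
Proof.
move=> lC T0; set m := #|T|.-1; set X := [set s | _].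
pose Xg g := [set s : m.-tuple letter | word s && (wprod s == C ^ g)].
have conjK g : cancel (fun s : m.-tuple letter => [tuple of conj_word g s])
    (fun s : m.-tuple letter => [tuple of conj_word g^-1 s]).
  move=> s; apply: val_inj => /=; rewrite /conj_word -map_comp map_id_in //.
  by move=> [b t] _; rewrite /= conjgK.
have XgE g : #|Xg g| = #|X|.
  rewrite -(card_imset (mem X) (can_inj (conjK g))); apply: eq_card => s.
  rewrite inE; apply/idP/imsetP => [/andP[ws /eqP sE]|[u]].
    exists [tuple of conj_word g^-1 s]; last first.
      by have := conjK g^-1 s; rewrite invgK.
    by rewrite inE conj_wordP ws wprod_conj sE conjgK eqxx.
  by rewrite inE => /andP[wu /eqP uE] ->;
    rewrite conj_wordP wu wprod_conj uE eqxx.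
have cT : #|{perm T}| = #|T|`!.
  have := card_perm [set: T]; rewrite cardsT => <-; apply: eq_card => g.
  by rewrite inE; apply/esym/subsetP => x _; rewrite inE.
(* Double counting of the pairs [(g, s)] with [wprod s = C ^ g]: each [g] admits [#|X|] words, each
   word with a full cycle as product admits [#|T|] elements [g]. *)
have : \sum_(g : {perm T}) #|Xg g| =
    (#|[set s : m.-tuple letter | word s && (rlen (wprod s) == m)]| * #|T|)%N.
  under eq_bigr do rewrite -sum1_card.
  rewrite (exchange_big_dep (fun s : m.-tuple letter =>
    word s && (rlen (wprod s) == m))) /= => [|g s _]; last first.
    by rewrite inE => /andP[-> /eqP->]; rewrite rlenJ lC eqxx.
  rewrite -sum_nat_const; apply: eq_big => [s|s /andP[ws /eqP ls]].
    by rewrite inE.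
  rewrite sum1_card -(card_conj_full lC ls T0); apply: eq_card => g.
  by rewrite [RHS]inE -[LHS]/(s \in Xg g) inE ws eq_sym.
under eq_bigr do rewrite XgE.
rewrite sum_nat_const cT words_count // => E.
apply/eqP; rewrite -(eqn_pmul2r (fact_gt0 m)) -E.
have -> : #|T|`! = (#|T| * m`!)%N by rewrite /m; case: #|T| T0.
by rewrite [X in _ == X]mulnC mulnA.
Qed.

End CountingWords.

(** * Matchings as permutations *)

Lemma set2_eq (T : finType) (a b c d : T) : [set a; b] = [set c; d] ->
  (a = c /\ b = d) \/ (a = d /\ b = c).
Proof.
move=> E.
have : a \in [set c; d] by rewrite -E set21.
have : b \in [set c; d] by rewrite -E set22.
have : c \in [set a; b] by rewrite E set21.
have : d \in [set a; b] by rewrite E set22.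
rewrite !inE.
by do 4!case/orP=> /eqP ?; subst; auto.
Qed.

Definition pred_perm n : {perm 'I_n} := perm (@ord_pred_inj n).

Lemma pred_permE n (i : 'I_n) : pred_perm n i = ord_pred i.
Proof. exact: permE. Qed.

Section Encoding.
Variable n : nat.
Implicit Types (f g : {perm 'I_n}) (i j k : 'I_n) (x y : 'I_(2 * n)).

Fact ev_subproof i : 2 * i < 2 * n. Proof. by rewrite ltn_pmul2l. Qed.
Fact od_subproof i : (2 * i).+1 < 2 * n.
Proof. by have := ltn_ord i; lia. Qed.
Definition ev i : 'I_(2 * n) := Ordinal (ev_subproof i).
Definition od i : 'I_(2 * n) := Ordinal (od_subproof i).

Lemma ev_inj : injective ev.
Proof. by move=> i j /(congr1 val) /= E; apply: val_inj => /=; lia. Qed.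

Lemma od_inj : injective od.
Proof. by move=> i j /(congr1 val) /= E; apply: val_inj => /=; lia. Qed.

Lemma ev_od i j : ev i <> od j.
Proof. by move/(congr1 val) => /= E; lia. Qed.

Lemma ev_surj x : ~~ odd x -> exists i, x = ev i.
Proof.
move=> xe; have xn : x./2 < n by have := ltn_ord x; lia.
by exists (Ordinal xn); apply: val_inj => /=; lia.
Qed.

Lemma od_surj x : odd x -> exists i, x = od i.
Proof.
move=> xo; have xn : x./2 < n by have := ltn_ord x; lia.
by exists (Ordinal xn); apply: val_inj => /=; lia.
Qed.

Lemma pred_ev i : ord_pred (ev i) = od (ord_pred i).
Proof.
case: i => i iN; apply: val_inj.
rewrite -[LHS]/((2 * i + 2 * n).-1 %% (2 * n))%N.
rewrite -[RHS]/((2 * ((i + n).-1 %% n)).+1)%N.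
case: i iN => [|i] iN; first by rewrite !modn_small; lia.
have -> : ((2 * i.+1 + 2 * n).-1 = (2 * i).+1 + 2 * n)%N by lia.
have -> : ((i.+1 + n).-1 = i + n)%N by lia.
by rewrite !modnDr !modn_small; lia.
Qed.

Lemma pred_od i : ord_pred (od i) = ev i.
Proof.
by apply: val_inj => /=; rewrite modnDr modn_small // ltn_pmul2l.
Qed.

Definition mset f : {set {set 'I_(2 * n)}} := [set [set ev i;
  od (f i)] | i : 'I_n].

Lemma msetP f x y : [set x; y] \in mset f ->
  exists i, (x = ev i /\ y = od (f i)) \/ (x = od (f i) /\ y = ev i).
Proof. by case/imsetP=> i _ /set2_eq[]; exists i; [left | right]. Qed.

Lemma mem_mset f i : [set ev i; od (f i)] \in mset f.
Proof. exact: imset_f. Qed.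

Lemma mem_msetV f j : [set od j; ev (f^-1 j)] \in mset f.
Proof. by have := mem_mset f (f^-1 j); rewrite permKV setUC. Qed.

Lemma mset_ev f i y : [set ev i; y] \in mset f -> y = od (f i).
Proof.
by case/msetP=> j [[/ev_inj-> ->]|[/ev_od]].
Qed.

Lemma mset_inj : injective mset.
Proof.
move=> f g fg; apply/permP => i; apply: od_inj; apply: mset_ev.
by rewrite -fg mem_mset.
Qed.

Lemma matching_mset f : matching (mset f).
Proof.
apply/andP; split; last first.
  apply/forallP => B; apply/implyP => /imsetP[i _ ->].
  by rewrite cards2; case: (eqVneq (ev i)) => // E; case: (ev_od E).
apply/and3P; split.
- rewrite eqEsubset subsetT; apply/subsetP => x _; apply/bigcupP.
  have [/od_surj[i ->]|/ev_surj[i ->]] := boolP (odd x).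
    by exists [set od i; ev (f^-1 i)]; rewrite ?set21 ?mem_msetV.
  by exists [set ev i; od (f i)]; rewrite ?set21 ?mem_mset.
- apply/trivIsetP => _ _ /imsetP[i _ ->] /imsetP[j _ ->] ij.
  have {}ij : i != j by apply: contraNneq ij => ->.
  rewrite -setI_eq0; apply/eqP/setP => x; rewrite !inE.
  apply/negP => /andP[/orP[]/eqP-> /orP[]/eqP].
  + by move/ev_inj => E; rewrite E eqxx in ij.
  + by move=> E; case: (ev_od E).
  + by move=> E; case: (ev_od (esym E)).
  + by move/od_inj/perm_inj => E; rewrite E eqxx in ij.
- by apply/imsetP => -[i _ /setP/(_ (ev i))]; rewrite !inE eqxx.
Qed.

(** The pair of 2i and 2f(i) + 1 becomes that of 2f(i) and 2(i - 1) + 1, so the new permutation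
    sends f(i) to i - 1. *)
Lemma shift_mset f : shift (mset f) = mset (f^-1 * pred_perm n).
Proof.
have im i : [set ord_pred z | z in [set ev i; od (f i)]]
    = [set ev (f i); od ((f^-1 * pred_perm n) (f i))].
  by rewrite imsetU !imset_set1 pred_ev pred_od permM permK pred_permE setUC.
apply/setP => B; apply/imsetP/imsetP => [[_ /imsetP[i _ ->] ->]|[i _ ->]].
  by exists (f i); rewrite ?im.
by exists [set ev (f^-1 i); od (f (f^-1 i))]; rewrite ?mem_mset // im permKV.
Qed.

Lemma mset_swap f i j : i != j -> mset (tperm i j * f) =
  (mset f :\: [set [set ev i; od (f i)]; [set ev j; od (f j)]])
    :|: [set [set ev i; od (f j)]; [set ev j; od (f i)]].
Proof.
move=> ij; have neq u v : u != v -> [set ev u; od (f u)] != [set ev v;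
  od (f v)].
  by apply: contraNneq => /set2_eq[[/ev_inj->]|[/ev_od]].
apply/setP => B; rewrite !inE; apply/imsetP/idP => [[k _ ->]|].
  rewrite permM; case: tpermP => [->|->|/eqP ki /eqP kj].
  - by rewrite eqxx orbT.
  - by rewrite eqxx !orbT.
  - by rewrite !negb_or !neq ?mem_mset.
case/orP=> [/andP[nB /imsetP[k _ BE]]|/orP[]/eqP->].
- exists k => //; rewrite permM BE tpermD //; apply: contra nB => /eqP->;
  by rewrite BE eqxx ?orbT.
- by exists i; rewrite // permM tpermL.
- by exists j; rewrite // permM tpermR.
Qed.

Lemma pflip_tperm f i j : i != j -> flip_perm f (tperm i j * f).
Proof. by move=> ij; rewrite /flip_perm mulgK rlen_tperm. Qed.

Lemma is_flip_mset f g : is_flip (mset f) (mset g) = flip_perm f g.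
Proof.
apply/idP/idP; last first.
  move/eqP/rlen1P => [i [j [ij E]]].
  have -> : g = tperm i j * f by rewrite -E mulgKV.
  apply/existsP; exists (ev i); apply/existsP; exists (od (f i)).
  apply/existsP; exists (ev j); apply/existsP; exists (od (f j)).
  apply/and4P; split; rewrite ?mem_mset //.
    by apply: contraNneq ij => /set2_eq[[/ev_inj->]|[/ev_od]].
  by rewrite mset_swap // (setUC [set od (f i)]).
case/existsP=> x /existsP[y /existsP[z /existsP[w /and4P[xy zw ne /eqP E]]]].
have : [set x; w] \in mset g by rewrite E !inE eqxx orbT.
(* The two mixed orientations would make [[set x; w]] a pair of [mset g] with ends of equal
   parity. *)
case/msetP: xy E ne => i [] [-> ->]; case/msetP: zw => j [] [-> ->] E ne.
- move=> _; have ij : i != j by apply: contraNneq ne => ->.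
  by rewrite (setUC [set od (f i)]) -mset_swap // in E;
    rewrite (mset_inj E) pflip_tperm.
- by case/msetP=> k [] [] => [_ /ev_od|/ev_od].
- by case/msetP=> k [] [] => [/esym/ev_od|_ /esym/ev_od].
- move=> _; have ij : i != j by apply: contraNneq ne => ->.
  rewrite ![[set od _; ev _]]setUC [[set [set ev j; _]; _]]setUC in E.
  by rewrite -mset_swap // in E; rewrite (mset_inj E) pflip_tperm.
Qed.

End Encoding.

(** * Noncrossing matchings and numbers of cycles *)

Lemma val_pred k (x : 'I_k) : 0 < x -> ord_pred x = x.-1 :> nat.
Proof.
case: x => -[|x] //= xk _; rewrite -[RHS]/x.
by rewrite modnDr modn_small // ltnW.
Qed.

Lemma rlen_pred_perm k : rlen (pred_perm k) = k.-1.
Proof.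
case: k => [|k]; first by have := rlen_porbits (pred_perm 0);
  rewrite card_ord; lia.
have orb m (x : 'I_k.+1) : x = m :> nat ->
    porbit (pred_perm k.+1) x = porbit (pred_perm k.+1) ord0.
  elim: m x => [|m IHm] x xm; first by congr porbit; apply: val_inj.
  rewrite -(porbit_perm _ 1) expg1; apply: IHm.
  by rewrite pred_permE val_pred xm.
suffices E : porbits (pred_perm k.+1) = [set porbit (pred_perm k.+1) ord0].
  by have := rlen_porbits (pred_perm k.+1); rewrite E cards1 card_ord; lia.
apply/setP => S; rewrite inE; apply/imsetP/eqP => [[x _ ->]|->].
  exact: orb.
by exists ord0.
Qed.

Lemma porbit_imset (T U : finType) (e : T -> U) (p : {perm T}) (q : {perm U}) :
  injective e -> (forall i, q (e i) = e (p i)) ->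
  forall i, porbit q (e i) = e @: porbit p i.
Proof.
move=> eI qe i; have iterE m : (q ^+ m) (e i) = e ((p ^+ m) i).
  elim: m => [|m IHm]; first by rewrite !perm1.
  by rewrite !expgSr !permM IHm qe.
apply/setP => y; apply/porbitP/imsetP => [[m ->]|[_ /porbitP[m ->] ->]].
  by exists ((p ^+ m) i); rewrite ?mem_porbit // iterE.
by exists m; rewrite iterE.
Qed.

Section Noncrossing.
Variable n : nat.
Implicit Types (f g : {perm 'I_n}) (i j k : 'I_n) (x y z w a b : 'I_(2 * n)).
Implicit Types (L : seq 'I_n).

Lemma noncrossingN (M : {set {set 'I_(2 * n)}}) x y z w :
  noncrossing M -> x < y -> y < z -> z < w ->
  [set x; z] \in M -> [set y; w] \in M -> False.
Proof.
move=> /negP ncM xy yz zw xz yw; apply: ncM.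
apply/existsP; exists x; apply/existsP; exists y.
apply/existsP; exists z; apply/existsP; exists w.
by rewrite xy yz zw xz yw.
Qed.

(** The involution exchanging the ends of the pairs indexed by [L]; the list lets pairs be added one
    at a time. *)
Definition mperm f L : {perm 'I_(2 * n)} :=
  \prod_(i <- L) tperm (ev i) (od (f i)).

Lemma mpermP f L i : uniq L ->
  mperm f L (ev i) = (if i \in L then od (f i) else ev i)
  /\ mperm f L (od (f i)) = (if i \in L then ev i else od (f i)).
Proof.
rewrite /mperm; elim: L => [|j L IHL]; first by rewrite big_nil !perm1.
rewrite big_cons inE !permM /= => /andP[jL /IHL[IH1 IH2]].
have evod (u v : 'I_n) : ev u != od v by apply/eqP/ev_od.
have [E|ij] := eqVneq i j.
  by rewrite E (negPf jL) in IH1 IH2 *; rewrite tpermL tpermR IH1 IH2.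
have n1 : ev j != ev i by rewrite (inj_eq (@ev_inj n)) eq_sym.
have n2 : od (f j) != od (f i).
  by rewrite (inj_eq (@od_inj n)) (inj_eq perm_inj) eq_sym.
have n3 (u v : 'I_n) : od v != ev u by rewrite eq_sym.
by rewrite !tpermD.
Qed.

Lemma mperm_mset f L x : uniq L ->
  mperm f L x = x \/ [set x; mperm f L x] \in mset f.
Proof.
move=> uL.
have [/od_surj[i ->]|/ev_surj[i ->]] := boolP (odd x); last first.
  have [-> _] := mpermP f i uL; case: ifP => _; [right | by left].
  exact: mem_mset.
have [_] := mpermP f (f^-1 i) uL; rewrite permKV => ->.
case: ifP => _; [right | by left].
exact: mem_msetV.
Qed.

Lemma mperm_full f x y : [set x; y] \in mset f -> mperm f (enum 'I_n) x = y.
Proof.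
move=> /msetP[i Exy]; have [] := mpermP f i (enum_uniq 'I_n).
by rewrite mem_enum => E1 E2; case: Exy => -[-> ->].
Qed.

(** As no pair crosses the arc, [q] maps the interval (a, b] into [a, b). If the orbit of [b]
    avoided [a], it would stay in (a, b] and never return to [b]. *)
Lemma noncrossing_arc f L a b : noncrossing (mset f) -> uniq L ->
  [set a; b] \in mset f -> a < b -> mperm f L a = a -> mperm f L b = b ->
  a \in porbit (mperm f L * pred_perm (2 * n)) b.
Proof.
move=> nc uL abM ab ma mb; set m := mperm f L in ma mb *; set q := _ * _.
have qv y : 0 < m y -> q y = (m y).-1 :> nat.
  by move=> my; rewrite permM pred_permE val_pred.
have qarc y : a < y <= b -> a <= q y < b.
  case/andP=> ay; rewrite leq_eqVlt => /orP[/eqP/val_inj yb|yb].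
    by rewrite qv yb mb; lia.
  suffices : a < m y < b by move=> my; rewrite qv; lia.
  have [->|yM] := mperm_mset f y uL; first by rewrite ay.
  rewrite -/m in yM.
  have mya : m y != a.
    by rewrite -ma (inj_eq perm_inj); apply/eqP => ya; rewrite ya in ay; lia.
  have myb : m y != b.
    by rewrite -mb (inj_eq perm_inj); apply/eqP => ya; rewrite ya in yb; lia.
  have [mya'|mya'] := ltnP (m y) a.
    by case: (noncrossingN nc mya' ay yb) => //; rewrite setUC.
  have [myb'|myb'] := ltnP b (m y).
    by case: (noncrossingN nc ay yb myb').
  by rewrite !ltn_neqAle mya' myb' myb eq_sym mya.
apply: contraT => nab.
have orb y : y \in porbit q b -> (y \in porbit q b) && (a < y <= b).
  apply: (porbit_sub_closed (S := fun y => (y \in porbit q b) && (a < y <= b))).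
    move=> z /andP[zb /qarc/andP[az zb']].
    have qzb : q z \in porbit q b by apply: porbit_trans zb (porbit_step q z).
    rewrite qzb (ltnW zb') ltn_neqAle az !andbT.
    by apply: contraNneq nab => /val_inj->.
  by rewrite porbit_id ab leqnn.
have /andP[_ /qarc] := orb _ (porbit_inv_step q b).
by rewrite permKV ltnn andbF.
Qed.

(** Starting from the 2n-cycle, each added pair has both ends in one orbit and so splits a cycle:
    the planar case of Euler's formula. *)
Lemma rlen_mperm_pred f L : noncrossing (mset f) -> uniq L ->
  rlen (mperm f L * pred_perm (2 * n)) + size L = (2 * n).-1.
Proof.
move=> nc; elim: L => [|i L IHL] /=.
  by rewrite /mperm big_nil mul1g addn0 rlen_pred_perm.
case/andP=> iL uL; rewrite -{}IHL // {1}/mperm big_cons -/(mperm f L) -mulgA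
  addnS -addSn.
congr (_ + _); apply: rlen_tpermM_split; first by apply/eqP/ev_od.
have [] := mpermP f i uL; rewrite (negPf iL) => m1 m2.
have M := mem_mset f i.
have [lt|lt|/val_inj/ev_od//] := ltngtP (ev i) (od (f i)).
  by rewrite porbit_sym; apply: noncrossing_arc.
by apply: noncrossing_arc => //; rewrite setUC.
Qed.

Lemma rlen_mperm f L : rlen (mperm f L) <= size L.
Proof.
rewrite /mperm; elim: L => [|i L IHL]; first by rewrite big_nil rlen1.
rewrite big_cons /=; have := rlen_tpermM_le (ev i) (od (f i)) (mperm f L).
by rewrite /mperm; rlia.
Qed.

(** Suppose pairs [x z] and [y w] cross. Lengths add up in [SE], so [y] and [w] share an orbit of
    [tperm x z * S]; but that permutation preserves the interval [x, z), which contains [y] and not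
    [w]. *)
Lemma noncrossing_rlen f : rlen (mperm f (enum 'I_n) * pred_perm (2 * n)) =
  n.-1 ->
  noncrossing (mset f).
Proof.
set m := mperm _ _; set S := pred_perm _ => lq; apply/negP.
case/existsP=> x /existsP[y /existsP[z /existsP[w /and5P[xy yz zw xzM ywM]]]].
have mV u v : [set u; v] \in mset f -> m^-1 u = v.
  by rewrite setUC => /mperm_full <-; rewrite permK.
have xz : x != z by apply/eqP => xz; rewrite xz in xy; lia.
have lm : (rlen (tperm x z * m^-1)).+1 = rlen m.
  by rewrite -(rlenV m) rlen_tpermM_split // -(mV _ _ xzM) porbit_step.
have lmn : rlen m <= n by rewrite -[X in _ <= X]card_ord cardE rlen_mperm.
have SE : tperm x z * S = (tperm x z * m^-1) * (m * S) by rewrite -!mulgA mulKg.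
have lS := rlen_subadd (tperm x z * m^-1) (m * S).
have lS2 := rlen_subadd (tperm x z) (tperm x z * S).
rewrite mulgA tperm2 mul1g rlen_pred_perm rlen_tperm // in lS2.
have [cm _] : finer (tperm x z * m^-1) (tperm x z * S)
    /\ finer (m * S) (tperm x z * S).
  rewrite {1 2}SE; apply: finer_mul; apply/eqP; rewrite eqn_leq lS /= -SE lq.
  by have := ltn_ord w; rlia.
have yw : w \in porbit (tperm x z * S) y.
  have := cm y; rewrite permM tpermD ?(mV _ _ ywM) //.
    by apply/eqP => E; rewrite E in xy; lia.
  by apply/eqP => E; rewrite E in yz; lia.
suffices : x <= w < z by lia.
apply: (porbit_sub_closed (S :=
  fun u : 'I_(2 * n) => x <= u < z)) yw => [u /andP[xu uz]|].
  rewrite permM pred_permE; case: tpermP => [_|E|/eqP ux uz'].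
  - by rewrite val_pred; lia.
  - by rewrite E in uz; lia.
  - have {}xu : x < u by rewrite ltn_neqAle xu eq_sym ux.
    by rewrite val_pred; lia.
by rewrite (ltnW xy).
Qed.

(** The permutation [q] preserves parity: it acts as [f] on the even points and as [g] on the odd
    ones. *)
Lemma porbits_mperm_pred f :
  #|porbits (mperm f (enum 'I_n) * pred_perm (2 * n))|
  = #|porbits f| + #|porbits (f^-1 * pred_perm n)|.
Proof.
set q := _ * _; set g := f^-1 * _.
have evE i : q (ev i) = ev (f i).
  by rewrite permM pred_permE (mperm_full (mem_mset f i)) pred_od.
have odE i : q (od i) = od (g i).
  by rewrite !permM (mperm_full (mem_msetV f i)) !pred_permE pred_ev.
have evO := porbit_imset (@ev_inj n) evE;
  have odO := porbit_imset (@od_inj n) odE.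
have -> : porbits q = [set @ev n @: B | B : {set 'I_n} in porbits f]
    :|: [set @od n @: B | B : {set 'I_n} in porbits g].
  apply/setP => B; rewrite inE; apply/imsetP/orP => [[x _ ->]|].
    have [/od_surj[i ->]|/ev_surj[i ->]] := boolP (odd x).
      by right; rewrite odO; apply: imset_f; apply: imset_f.
    by left; rewrite evO; apply: imset_f; apply: imset_f.
  by case=> /imsetP[_ /imsetP[i _ ->] ->]; [exists (ev i)|exists (od i)].
rewrite cardsU (card_imset _ (imset_inj (@ev_inj n))).
rewrite (card_imset _ (imset_inj (@od_inj n))).
rewrite (_ : _ :&: _ = set0) ?cards0 ?subn0 //.
apply/setP => B; rewrite !inE; apply/negP => /andP[].
case/imsetP=> _ /imsetP[i _ ->] -> /imsetP[D _ /setP/(_ (ev i))].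
rewrite imset_f ?porbit_id // => /esym/imsetP[j _].
exact: ev_od.
Qed.

(** By the cycle count, [rlen f + rlen (kreweras f)] is the length of
    [mperm f (enum 'I_n) * pred_perm (2 * n)], which is [n.-1] exactly in the noncrossing case. *)
Lemma noncrossing_mset f : 0 < n ->
  noncrossing (mset f) = nc (pred_perm n) f.
Proof.
move=> n0; have pE := porbits_mperm_pred f.
have := rlen_porbits (mperm f (enum 'I_n) * pred_perm (2 * n));
  rewrite pE card_ord.
have := rlen_porbits f; have := rlen_porbits (f^-1 * pred_perm n).
rewrite !card_ord /nc /kreweras rlen_pred_perm => l1 l2 lq.
apply/idP/eqP => [nc|nc].
  have := rlen_mperm_pred nc (enum_uniq 'I_n); rewrite -cardE card_ord.
  by rlia.
by apply: noncrossing_rlen; rlia.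
Qed.

End Noncrossing.

(** * Counting necklaces *)

Section Surjectivity.
Variable n : nat.
Implicit Types (M : {set {set 'I_(2 * n)}}) (a b x y : 'I_(2 * n)).

Lemma matching_card2 M B : matching M -> B \in M -> #|B| = 2.
Proof. by case/andP=> _ /forallP/(_ B)/implyP B2 /B2/eqP. Qed.

Lemma matching_eq M B B' x : matching M ->
  B \in M -> B' \in M -> x \in B -> x \in B' -> B = B'.
Proof.
case/andP=> /and3P[_ /trivIsetP tI _] _ BM BM' xB xB'.
apply/eqP; apply: contraT => ne; have /pred0P/(_ x) := tI _ _ BM BM' ne.
by rewrite /= xB xB'.
Qed.

Lemma matching_partner M x : matching M -> exists y, [set x; y] \in M.
Proof.
move=> mM; have /andP[/and3P[/eqP cM _ _] _] := mM.
have : x \in cover M by rewrite cM inE.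
case/bigcupP=> B BM; have /eqP/cards2P[a [b [_ BE]]] := matching_card2 mM BM.
rewrite BE in BM *; rewrite !inE => /orP[]/eqP->; first by exists b.
by exists a; rewrite setUC.
Qed.

(* The points strictly between the ends of a pair are matched among
   themselves, so there is an even number of them. *)
Lemma noncrossing_parity M a b : matching M -> noncrossing M ->
  [set a; b] \in M -> a < b -> odd a != odd b.
Proof.
move=> mM nM abM ab.
pose I := [set x : 'I_(2 * n) | a < x < b].
have closed B x y : B \in M -> x \in B -> y \in B -> x \in I -> y \in I.
  move=> BM xB yB; rewrite !inE => /andP[ax xb].
  have [->|xy] := eqVneq y x; first by rewrite ax xb.
  have BE : B = [set x; y].
    apply/esym/eqP; rewrite eqEcard (matching_card2 mM BM) cards2 eq_sym xy
      andbT.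
    by apply/subsetP => z; rewrite !inE => /orP[]/eqP->.
  have ne z : z \in [set a; b] -> y != z.
    move=> zab; apply/eqP => yz.
    have := matching_eq mM BM abM yB; rewrite yz => /(_ zab) BE'.
    move: xB; rewrite BE' !inE => /orP[]/eqP xE.
      by rewrite xE ltnn in ax.
    by rewrite xE ltnn in xb.
  have ya := ne a (set21 a b); have yb := ne b (set22 a b).
  rewrite BE in BM; have [lya|lya] := ltnP y a.
    by case: (noncrossingN nM lya ax xb) => //; rewrite setUC.
  have [lyb|lyb] := ltnP b y.
    by case: (noncrossingN nM ax xb lyb).
  by rewrite !ltn_neqAle lya lyb yb eq_sym ya.
pose P := [set B in M | B \subset I].
have pI : partition P I.
  have /andP[/and3P[/eqP cM tM M0] _] := mM.
  apply/and3P; split; last by rewrite inE (negPf M0).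
    rewrite eqEsubset; apply/andP; split.
      by apply/bigcupsP => B; rewrite inE => /andP[].
    apply/subsetP => x xI; have : x \in cover M by rewrite cM inE.
    case/bigcupP=> B BM xB; apply/bigcupP; exists B => //; rewrite inE BM.
    by apply/subsetP => y yB; apply: closed BM xB yB xI.
  by apply/trivIsetP => B B'; rewrite !inE => /andP[BM _] /andP[BM' _];
    apply: (trivIsetP tM).
have cI : #|I| = (#|P| * 2)%N.
  apply: card_uniform_partition pI => B; rewrite inE => /andP[BM _].
  exact: matching_card2 BM.
have cI' : #|I| = (b - a.+1)%N.
  rewrite -sum1_card; transitivity (\sum_(x < 2 * n | (x < b) && (a < x)) 1).
    by apply: eq_bigl => x; rewrite inE andbC.
  rewrite -(big_mkord (fun k => (k < b) && (a < k)) (fun=> 1%N)).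
  rewrite -(big_nat_widenl _ _ _ (fun k => k < b)) //.
  by rewrite -(big_nat_widen _ _ _ xpredT) ?sum_nat_const_nat ?muln1 // ltnW.
by move: cI; rewrite cI'; lia.
Qed.

Lemma noncrossing_msetP M : matching M -> noncrossing M ->
  exists f, M = mset f.
Proof.
move=> mM nM.
have parity x y : [set x; y] \in M -> odd x != odd y.
  move=> xyM; have [xy|yx|/val_inj xy] := ltngtP x y.
  - exact: noncrossing_parity xyM xy.
  - by rewrite eq_sym; apply: (noncrossing_parity mM nM _ yx); rewrite setUC.
  - by have := matching_card2 mM xyM; rewrite xy setUid cards1.
have : forall i, exists j, [set ev i; od j] \in M.
  move=> i; have [y iyM] := matching_partner (ev i) mM.
  have /od_surj[j yE] : odd y by have := parity _ _ iyM; rewrite /=; lia.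
  by exists j; rewrite -yE.
case/fin_all_exists => f fM.
have fI : injective f.
  move=> i j fij; have := fM j; rewrite -fij => fjM.
  have := matching_eq mM (fM i) fjM (set22 _ _) (set22 _ _).
  by case/set2_eq=> [[/ev_inj]|[/ev_od]].
exists (perm fI); apply/setP => B; apply/idP/imsetP => [BM|[i _ ->]];
  last first.
  by rewrite permE fM.
have iB i : ev i \in B -> B = [set ev i; od (perm fI i)].
  by move=> iB; rewrite permE; apply: matching_eq mM BM (fM i) iB (set21 _ _).
have /eqP/cards2P[x [y [_ BE]]] := matching_card2 mM BM.
have := BM; rewrite BE => /parity.
have [xo|/ev_surj[i xE] _] := boolP (odd x); last first.
  by exists i => //; rewrite -BE; apply: iB; rewrite BE xE set21.
have [//|/ev_surj[i yE] _] := boolP (odd y).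
by exists i => //; rewrite -BE; apply: iB; rewrite BE yE set22.
Qed.

End Surjectivity.

(** * From necklaces to factorizations of the long cycle *)

Section CountingNecklaces.

Lemma size_walk (T : finType) (s : seq (bool * {perm T})) :
  size (walk s) = (size s).+1.
Proof. by rewrite /= size_scanl. Qed.

(** The map [walk] is a bijection: marks and letters are recovered by [scanl_step_inj], and
    [decodeP] yields a preimage. *)
Lemma necklace_perms_count (T : finType) (C : {perm T}) m : rlen C = m ->
  #|[set r : m.+1.-tuple {perm T} | necklace_perm C r]|
  = #|[set s : m.-tuple (bool * {perm T}) | word s && (wprod s == C)]|.
Proof.
move=> lC.
have sz (s : m.-tuple (bool * {perm T})) : size (walk s) == m.+1.
  by rewrite size_walk size_tuple.
pose W s := Tuple (sz s).
rewrite -(card_in_imset (f := W)); last first.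
  move=> s s'; rewrite !inE => /andP[ws /eqP CE] /andP[ws' /eqP CE'].
  move/(congr1 val) => /= [uE scE]; apply: val_inj => /=.
  have [|_ v] := walk_factorization ws CE; first by rewrite size_tuple lC.
  have [|_ v'] := walk_factorization ws' CE'; first by rewrite size_tuple lC.
  by rewrite -uE in scE v'; apply: scanl_step_inj v v' scE.
apply: eq_card => r; rewrite inE; apply/idP/imsetP => [|[s]].
  case: r => -[|A r] // szr nr; have /and3P[_ sr _] := nr.
  have [ws vs sE] := decodeP sr.
  set s := pairmap (@decode1 T) A r in ws vs sE.
  have szs : size s == m by rewrite size_pairmap.
  have [||uA CE] := factorization_walk (C := C) ws vs.
  - by rewrite (eqP szs) lC.
  - by rewrite sE.
  exists (Tuple szs); first by rewrite inE /= ws /wprod CE eqxx.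
  by apply: val_inj; rewrite /= /walk uA sE.
rewrite inE => /andP[ws /eqP CE] ->.
by have [] := walk_factorization ws CE; first by rewrite size_tuple lC.
Qed.

Lemma necklaces_count n : 0 < n ->
  #|[set t : n.-tuple {set {set 'I_(2 * n)}} | necklace t]|
  = #|[set r : n.-tuple {perm 'I_n} | necklace_perm (pred_perm n) r]|.
Proof.
move=> n0; pose E (r : n.-tuple {perm 'I_n}) := [tuple of map (@mset n) r].
have EI : injective E.
  by move=> r r' /(congr1 val) /= /(inj_map (@mset_inj n)) /val_inj.
have nE r : necklace (E r) = necklace_perm (pred_perm n) r.
  rewrite /necklace /necklace_perm; congr [&& _, _ & _].
  - rewrite all_map; apply: eq_all => f /=.
    by rewrite matching_mset noncrossing_mset.
  - by rewrite sorted_map; apply: eq_sorted => f g; apply: is_flip_mset.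
  (* The default values matter only for the empty tuple, excluded by [n0]. *)
  - case: r n0 => -[|f r] /= => [/eqP <- //|_ _].
    by rewrite last_map shift_mset (inj_eq (@mset_inj n)).
rewrite -(card_imset _ EI); apply: eq_card => t; rewrite inE.
apply/idP/imsetP => [nt|[r]]; last by rewrite inE -nE => nr ->.
have /fin_all_exists[F FE] i : exists f, tnth t i = mset f.
  have /and3P[/allP nt' _ _] := nt.
  by have /andP[] := nt' _ (mem_tnth i t); apply: noncrossing_msetP.
have tE : t = E [tuple F i | i < n].
  by apply: eq_from_tnth => i; rewrite tnth_map tnth_mktuple.
by exists [tuple F i | i < n]; rewrite // inE -nE -tE.
Qed.

End CountingNecklaces.

Local Open Scope ring_scope.

Theorem theorem1p6 (n : nat) (hn : (1 <= n)%N) :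
  #|[set t : n.-tuple {set {set 'I_(2 * n)}} | necklace t]|%:R
    = 2 * (2 * n%:R) ^ (n%:Z - 2) :> rat.
Proof.
rewrite necklaces_count //; case: n hn => // m _.
rewrite necklace_perms_count ?rlen_pred_perm //.
have := @factorizations_count _ (pred_perm m.+1).
rewrite card_ord rlen_pred_perm => /(_ erefl isT).
move/(congr1 (fun k => k%:R : rat)); rewrite natrM natrX natrM => E.
have m0 : m.+1%:R != 0 :> rat by rewrite pnatr_eq0.
apply: (mulIf m0); rewrite E.
(* The exponent is -1 when [m = 0], so one factor [2 * m.+1%:R] is split off as an inverse; it
   cancels against the outer 2 and [m.+1%:R]. *)
have -> : m.+1%:Z - 2 = m%:Z - 1 by lia.
have m2 : (2 * m.+1%:R : rat) != 0 by rewrite mulf_neq0.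
by rewrite expfzDr // exprN1 -exprnP; field; rewrite nat1r.
Qed.
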